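(* For integers $m,u,p\ge 1$ and $n,v\ge 0$, in $\mathfrak{h}_t^1$ $$ \begin{aligned} z_m z_p^n \overset{t}{\ast} z_u z_p^v ={}&\sum_{i=1}^{n}z_m\big\{z_p^i z_u+(1-2t)z_p^{i-1}z_{u+p}+(1-\delta_{v,0}\delta_{n,i})(t^2-t)z_p^{i-1}x^{u+p}\big\}\big(z_p^{v}\overset{t}{\ast} z_p^{n-i}\big)\\ &+\sum_{i=1}^{v}z_u\big\{z_p^i z_m+(1-2t)z_p^{i-1}z_{m+p}+(1-\delta_{n,0}\delta_{v,i})(t^2-t)z_p^{i-1}x^{m+p}\big\}\big(z_p^{n}\overset{t}{\ast} z_p^{v-i}\big)\\ &+\big\{z_m z_u+z_u z_m+(1-2t)z_{m+u}+(1-\delta_{n,0}\delta_{v,0})(t^2-t)x^{m+u}\big\}\big(z_p^{n}\overset{t}{\ast} z_p^{v}\big). \end{aligned} $$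
   Context: Let $A=\{x,y\}$ be two noncommuting letters, $A^*$ the set of all words in $A$ including the empty word $1$, and $\mathfrak{h}_t=\mathbb{Q}[t]\langle A\rangle$ the noncommutative polynomial algebra over $\mathbb{Q}[t]$ generated by $A$ (product = concatenation). Put $\mathfrak{h}_t^1=\mathbb{Q}[t]+\mathfrak{h}_t y$ and, for each positive integer $k$, $z_k=x^{k-1}y$. The t-stuffle product $\overset{t}{\ast}$ on $\mathfrak{h}_t^1$ is the $\mathbb{Q}[t]$-bilinear product determined by: (i) $1\overset{t}{\ast}w=w\overset{t}{\ast}1=w$; (ii) $$z_kw_1\overset{t}{\ast} z_lw_2 = z_k(w_1\overset{t}{\ast} z_lw_2) + z_l(z_kw_1\overset{t}{\ast} w_2)+(1-2t)z_{k+l}(w_1\overset{t}{\ast} w_2)+ [1-\delta(w_1)\delta(w_2)](t^2-t)x^{k+l}(w_1\overset{t}{\ast} w_2)$$ for all words $w,w_1,w_2\in A^*\cap\mathfrak{h}_t^1$ and all positive integers $k,l$, where $\delta(w)=1$ if $w=1$ and $\delta(w)=0$ otherwise. $z_p^n$ is the $n$-fold concatenation power, $z_p^0=1$; $\delta_{i,j}$ is Kronecker's delta; empty sums are $0$. Juxtaposition denotes concatenation. *)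

(* Defs.v *)
From HB Require Import structures.
From mathcomp Require Import all_boot all_order all_algebra.
From mathcomp Require Import finmap.
From mathcomp.multinomials Require Import monalg.

Set Implicit Arguments.
Unset Strict Implicit.
Unset Printing Implicit Defensive.

Import GRing.Theory.
Local Open Scope ring_scope.

Variant letter := LX | LY.

Definition letter_to_bool (a : letter) : bool := if a is LY then true else false.
Definition bool_to_letter (b : bool) : letter := if b then LY else LX.
Lemma letter_to_boolK : cancel letter_to_bool bool_to_letter.
Proof. by case. Qed.
HB.instance Definition _ := Choice.copy letter (can_type letter_to_boolK).

Notation word := {fmonom letter}.
Notation Qt := {poly rat}.
Notation ht := {malg {poly rat}[{fmonom letter}]}.

Definition t : Qt := 'X.
Definition x : ht := << FMonom [:: LX] >>.
Definition y : ht := << FMonom [:: LY] >>.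

(* z k = x^(k-1) y is only meaningful for k > 0. *)
Definition z (k : nat) : ht := x ^+ k.-1 * y.

Definition in_ht1 (g : ht) : Prop := exists (c : Qt) (a : ht), g = c%:MP + a * y.

Definition delta (w : word) : Qt := (w == mone)%:R.

Definition kron (i j : nat) : Qt := (i == j)%:R.

(* The t-stuffle product of z_{k_1} ... z_{k_r} and z_{l_1} ... z_{l_s},
   with the two monomials given by their sequences of indices. *)
Fixpoint stuffle_idx (ks : seq nat) : seq nat -> ht :=
  fix aux (ls : seq nat) : ht :=
    match ks, ls with
    | [::], _ => \prod_(l <- ls) z l
    | _, [::] => \prod_(k <- ks) z k
    | k :: ks', l :: ls' =>
        z k * stuffle_idx ks' ls + z l * aux ls'
        + (1 - 2%:R * t) *: (z (k + l) * stuffle_idx ks' ls')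
        + ((1 - (nilp ks' && nilp ls')%:R) * (t ^+ 2 - t))
            *: (x ^+ (k + l) * stuffle_idx ks' ls')
    end.

(* Index sequence of a word: x^(k_1-1) y ... x^(k_r-1) y x^j is sent to
   [:: k_1; ...; k_r].  Such a word lies in ht^1 exactly when j = 0; the
   letters x^j of a word outside ht^1 are ignored, which is a junk value. *)
Fixpoint zidx_rec (c : nat) (s : seq letter) : seq nat :=
  match s with
  | [::] => [::]
  | LX :: s' => zidx_rec c.+1 s'
  | LY :: s' => c.+1 :: zidx_rec 0 s'
  end.

Definition zidx (w : word) : seq nat := zidx_rec 0 (w : seq letter).

(* Bilinear extension to the whole of ht; only the restriction to ht^1 is
   meaningful, and tstuffleP and tstuffle_unique below show that it is the
   t-stuffle product. *)
Definition tstuffle (f g : ht) : ht :=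
  \sum_(w1 <- msupp f) \sum_(w2 <- msupp g)
     (f@_w1 * g@_w2) *: stuffle_idx (zidx w1) (zidx w2).

Record is_tstuffle (star : ht -> ht -> ht) : Prop := IsTstuffle {
  star_closed f g : in_ht1 f -> in_ht1 g -> in_ht1 (star f g);
  star_linear_l (c : Qt) f1 f2 g : in_ht1 f1 -> in_ht1 f2 -> in_ht1 g ->
    star (c *: f1 + f2) g = c *: star f1 g + star f2 g;
  star_linear_r (c : Qt) f g1 g2 : in_ht1 f -> in_ht1 g1 -> in_ht1 g2 ->
    star f (c *: g1 + g2) = c *: star f g1 + star f g2;
  star_1l (w : word) : in_ht1 << w >> -> star 1 << w >> = << w >>;
  star_1r (w : word) : in_ht1 << w >> -> star << w >> 1 = << w >>;
  star_zz (k l : nat) (w1 w2 : word) : (0 < k)%N -> (0 < l)%N ->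
    in_ht1 << w1 >> -> in_ht1 << w2 >> ->
    star (z k * << w1 >>) (z l * << w2 >>) =
      z k * star << w1 >> (z l * << w2 >>)
      + z l * star (z k * << w1 >>) << w2 >>
      + (1 - 2%:R * t) *: (z (k + l) * star << w1 >> << w2 >>)
      + ((1 - delta w1 * delta w2) * (t ^+ 2 - t))
          *: (x ^+ (k + l) * star << w1 >> << w2 >>)
}.

Definition zword (s : seq nat) : word :=
  FMonom (flatten [seq rcons (nseq k.-1 LX) LY | k <- s]).

Lemma mulUU (w1 w2 : word) : << w1 >> * << w2 >> = << mmul w1 w2 >> :> ht.
Proof. by rewrite malgM_def fgmulUU mulr1. Qed.

Lemma word_eqP (w1 w2 : word) : (w1 : seq letter) = w2 -> w1 = w2.
Proof. by move=> h; apply/eqP; rewrite fmP h. Qed.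

Lemma xE n : x ^+ n = << FMonom (nseq n LX) >>.
Proof.
elim: n => [|n IH]; first by rewrite expr0; congr << _ >>; apply: word_eqP; rewrite fm1.
by rewrite exprS IH /x mulUU; congr << _ >>; apply: word_eqP; rewrite fmM.
Qed.

Lemma zE k : z k = << FMonom (rcons (nseq k.-1 LX) LY) >>.
Proof.
by rewrite /z xE mulUU; congr << _ >>; apply: word_eqP; rewrite fmM /= cats1.
Qed.

Lemma zwordE s : << zword s >> = \prod_(k <- s) z k :> ht.
Proof.
elim: s => [|k s IH].
  by rewrite big_nil; congr << _ >>; apply: word_eqP; rewrite fm1.
by rewrite big_cons -IH zE mulUU; congr << _ >>; apply: word_eqP; rewrite fmM.
Qed.

Lemma zidx_rec_nseq c n s : zidx_rec c (nseq n LX ++ s) = zidx_rec (c + n) s.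
Proof. by elim: n c => [|n IH] c /=; rewrite ?addn0 // IH addSnnS. Qed.

Lemma zidxK s : all (leq 1) s -> zidx (zword s) = s.
Proof.
rewrite /zidx /=; elim: s => //= k s IH /andP[k0 /IH {}IH].
by rewrite -cats1 -catA zidx_rec_nseq /= IH add0n prednK.
Qed.

Lemma zidx_rec_pos c s : all (leq 1) (zidx_rec c s).
Proof. by elim: s c => [|[] s IH] c //=. Qed.

Definition endsy (s : seq letter) : bool := last LY s == LY.

Lemma zwordK (w : word) : endsy w -> zword (zidx w) = w.
Proof.
move=> hw; apply: word_eqP => /=; rewrite /zidx.
suff H: forall s c, last LY s == LY -> (0 < size s)%N || (c == 0)%N ->
    flatten [seq rcons (nseq k.-1 LX) LY | k <- zidx_rec c s] = nseq c LX ++ s.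
  by rewrite (H _ 0) // orbT.
elim=> [|a s IH] c; first by move=> _ /= /eqP->.
case: a => /= hl _.
  rewrite IH; first by rewrite -cat_rcons; congr (_ ++ _); elim: c => //= c ->.
    by case: s hl {IH}.
  by case: s hl {IH}.
by rewrite -cats1 -catA IH ?orbT.
Qed.


Lemma in_ht1_supp_endsy (g : ht) (w : word) : in_ht1 g -> w \in msupp g -> endsy w.
Proof.
case=> c [a ->] hw.
have /fsubsetP/(_ w hw) := msuppD_le c%:MP (a * y).
rewrite in_fsetU => /orP[].
  by move/(fsubsetP (msuppC_le c)); rewrite in_fset1 => /eqP ->; rewrite /endsy fm1.
case/msuppM_le => k1 [k2 [_ /(fsubsetP msuppU_le)]].
by rewrite in_fset1 => /eqP -> ->; rewrite fmM cats1 /endsy last_rcons.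
Qed.

Lemma in_ht1_word (w : word) : in_ht1 << w >> -> endsy w.
Proof. by move/in_ht1_supp_endsy; apply; rewrite msuppU1 in_fset1. Qed.

Definition in_hty (g : ht) : Prop := exists a : ht, g = a * y.

Lemma in_hty1 g : in_hty g -> in_ht1 g.
Proof. by case=> a ->; exists 0, a; rewrite malgC0E add0r. Qed.

Lemma in_htyD f g : in_hty f -> in_hty g -> in_hty (f + g).
Proof. by case=> a -> [b ->]; exists (a + b); rewrite mulrDl. Qed.

Lemma in_htyM f g : in_hty g -> in_hty (f * g).
Proof. by case=> a ->; exists (f * a); rewrite mulrA. Qed.

Lemma in_htyZ c g : in_hty g -> in_hty (c *: g).
Proof. by case=> a ->; exists (c *: a); rewrite scalerAl. Qed.

Lemma in_ht10 : in_ht1 0.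
Proof. by exists 0, 0; rewrite malgC0E mul0r addr0. Qed.

Lemma in_ht11 : in_ht1 1.
Proof. by exists 1, 0; rewrite mul0r addr0. Qed.

Lemma in_ht1D f g : in_ht1 f -> in_ht1 g -> in_ht1 (f + g).
Proof.
case=> c [a ->] [d [b ->]]; exists (c + d), (a + b).
by rewrite mulrDl raddfD /= addrACA.
Qed.

Lemma in_ht1Z c g : in_ht1 g -> in_ht1 (c *: g).
Proof.
case=> d [a ->]; exists (c * d), (c *: a).
by rewrite scalerDr scalerAl -mul_malgC mpolyCM.
Qed.

Lemma in_ht1_sum (s : seq word) (F : word -> ht) :
  (forall w, w \in s -> in_ht1 (F w)) -> in_ht1 (\sum_(w <- s) F w).
Proof.
move=> h; rewrite big_seq; elim/big_ind: _ => //; [exact: in_ht10|exact: in_ht1D].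
Qed.


Lemma ht_mulC (a : ht) (c : Qt) : a * c%:MP = c *: a.
Proof.
rewrite (monalgE a) mulr_suml scaler_sumr; apply: eq_bigr => w _.
by rewrite -mul_malgC !malgM_def !fgmulUU mulm1 mul1m mulrC.
Qed.

Lemma ht_scaleAr (c : Qt) (f g : ht) : f * (c *: g) = c *: (f * g).
Proof. by rewrite -mul_malgC mulrA ht_mulC scalerAl. Qed.

Lemma lalg_mulDC (K : nzRingType) (A : lalgType K) (f g a d : A) (c : K) :
  f * g * d = c *: (f * g) -> f * g * (d + a * g) = (c *: f + f * g * a) * g.
Proof. by move=> h; rewrite mulrDr mulrDl h scalerAl mulrA. Qed.

Lemma zM_hty k g : in_ht1 g -> in_hty (z k * g).
Proof.
case=> c [a ->]; exists (c *: x ^+ k.-1 + z k * a).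
exact/lalg_mulDC/ht_mulC.
Qed.

Lemma prodz_ht1 ks : in_ht1 (\prod_(k <- ks) z k).
Proof.
elim: ks => [|k ks IH]; first by rewrite big_nil; apply: in_ht11.
by rewrite big_cons; apply/in_hty1/zM_hty.
Qed.

Lemma stuffle_idx0l ls : stuffle_idx [::] ls = \prod_(l <- ls) z l.
Proof. by case: ls. Qed.

Lemma stuffle_idx0r ks : stuffle_idx ks [::] = \prod_(k <- ks) z k.
Proof. by case: ks => //=; rewrite !big_nil. Qed.

Lemma stuffle_idx_cons k ks l ls : stuffle_idx (k :: ks) (l :: ls) =
  z k * stuffle_idx ks (l :: ls) + z l * stuffle_idx (k :: ks) ls
  + (1 - 2%:R * t) *: (z (k + l) * stuffle_idx ks ls)
  + ((1 - (nilp ks && nilp ls)%:R) * (t ^+ 2 - t))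
      *: (x ^+ (k + l) * stuffle_idx ks ls).
Proof. reflexivity. Qed.

Lemma stuffle_idx_ht ks ls :
  in_ht1 (stuffle_idx ks ls) /\
  (~~ (nilp ks && nilp ls) -> in_hty (stuffle_idx ks ls)).
Proof.
elim: ks ls => [|k ks IHk] ls.
  rewrite stuffle_idx0l; split; first exact: prodz_ht1.
  by case: ls => // l ls _; rewrite big_cons; apply/zM_hty/prodz_ht1.
elim: ls => [|l ls IHl].
  rewrite stuffle_idx0r; split; first exact: prodz_ht1.
  by rewrite big_cons => _; apply/zM_hty/prodz_ht1.
suff h : in_hty (stuffle_idx (k :: ks) (l :: ls)) by split=> [|_] //; apply: in_hty1.
have [h1 h2] := IHk ls.
have h3 := (IHk (l :: ls)).1; have h4 := IHl.1.
apply: in_htyD; last first.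
  case: (boolP (nilp ks && nilp ls)) => h.
    by rewrite subrr mul0r scale0r; exists 0; rewrite mul0r.
  by apply/in_htyZ/in_htyM/h2.
by apply: in_htyD; [apply: in_htyD; apply: zM_hty|apply/in_htyZ/zM_hty].
Qed.

Lemma ht_extE (V : lmodType Qt) (F : word -> V) (d : {fset word}) (f : ht) :
  (msupp f `<=` d)%fset ->
  \sum_(w <- msupp f) f@_w *: F w = \sum_(w <- d) f@_w *: F w.
Proof.
move=> h; apply: big_fset_incl => // w _ hw.
by rewrite mcoeff_outdom ?scale0r.
Qed.

Lemma ht_ext_linear (V : lmodType Qt) (F : word -> V) (c : Qt) (f g : ht) :
  \sum_(w <- msupp (c *: f + g)) (c *: f + g)@_w *: F w =
  c *: (\sum_(w <- msupp f) f@_w *: F w) + \sum_(w <- msupp g) g@_w *: F w.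
Proof.
pose d := (msupp f `|` msupp g)%fset.
rewrite !(@ht_extE _ _ d) ?fsubsetUl ?fsubsetUr //.
  rewrite scaler_sumr -big_split; apply: eq_bigr => w _ /=.
  by rewrite mcoeffD mcoeffZ scalerDl scalerA.
apply: fsubset_trans (msuppD_le _ _) _.
by rewrite fsetSU // msuppZ_le.
Qed.

Lemma tstuffleEl f g : tstuffle f g =
  \sum_(w1 <- msupp f)
     f@_w1 *: \sum_(w2 <- msupp g) g@_w2 *: stuffle_idx (zidx w1) (zidx w2).
Proof.
apply: eq_bigr => w1 _; rewrite scaler_sumr.
by apply: eq_bigr => w2 _; rewrite scalerA.
Qed.

Lemma tstuffleEr f g : tstuffle f g =
  \sum_(w2 <- msupp g)
     g@_w2 *: \sum_(w1 <- msupp f) f@_w1 *: stuffle_idx (zidx w1) (zidx w2).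
Proof.
rewrite /tstuffle exchange_big; apply: eq_bigr => w2 _ /=; rewrite scaler_sumr.
by apply: eq_bigr => w1 _; rewrite scalerA mulrC.
Qed.

Lemma tstuffle_linear_l c f1 f2 g :
  tstuffle (c *: f1 + f2) g = c *: tstuffle f1 g + tstuffle f2 g.
Proof. by rewrite !tstuffleEl ht_ext_linear. Qed.

Lemma tstuffle_linear_r c f g1 g2 :
  tstuffle f (c *: g1 + g2) = c *: tstuffle f g1 + tstuffle f g2.
Proof. by rewrite !tstuffleEr ht_ext_linear. Qed.

Lemma tstuffleUU (w1 w2 : word) :
  tstuffle << w1 >> << w2 >> = stuffle_idx (zidx w1) (zidx w2).
Proof.
by rewrite /tstuffle !msuppU1 !big_seq_fset1 !mcoeffUU mul1r scale1r.
Qed.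

Lemma wordP (w : word) : in_ht1 << w >> ->
  exists2 s, all (leq 1) s & w = zword s.
Proof.
move=> /in_ht1_word hw; exists (zidx w); first exact: zidx_rec_pos.
by rewrite zwordK.
Qed.

Lemma zMword k s : z k * << zword s >> = << zword (k :: s) >>.
Proof. by rewrite !zwordE big_cons. Qed.

Lemma word1 : 1 = << zword [::] >> :> ht.
Proof. by rewrite zwordE big_nil. Qed.

Lemma delta_zword s : delta (zword s) = (nilp s)%:R.
Proof. by rewrite /delta fmP fm1; case: s => // k s /=; case: (k.-1). Qed.

Opaque tstuffle stuffle_idx.

Lemma tstuffleP : is_tstuffle tstuffle.
Proof.
split.
- move=> f g _ _; apply: in_ht1_sum => w1 _; apply: in_ht1_sum => w2 _.
  exact/in_ht1Z/(stuffle_idx_ht _ _).1.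
- by move=> *; apply: tstuffle_linear_l.
- by move=> *; apply: tstuffle_linear_r.
- move=> w /wordP[s hs ->].
  by rewrite word1 tstuffleUU !zidxK // stuffle_idx0l zwordE.
- move=> w /wordP[s hs ->].
  by rewrite word1 tstuffleUU !zidxK // stuffle_idx0r zwordE.
move=> k l _ _ k0 l0 /wordP[s1 h1 ->] /wordP[s2 h2 ->].
have h1' : all (leq 1) (k :: s1) by rewrite /= k0.
have h2' : all (leq 1) (l :: s2) by rewrite /= l0.
suff H A B : A = << zword (k :: s1) >> -> B = << zword (l :: s2) >> ->
    tstuffle A B =
      z k * tstuffle << zword s1 >> B + z l * tstuffle A << zword s2 >>
      + (1 - 2%:R * t) *: (z (k + l) * tstuffle << zword s1 >> << zword s2 >>)
      + ((1 - delta (zword s1) * delta (zword s2)) * (t ^+ 2 - t))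
          *: (x ^+ (k + l) * tstuffle << zword s1 >> << zword s2 >>).
  exact: (H _ _ (zMword k s1) (zMword l s2)).
move=> -> ->; rewrite !tstuffleUU !delta_zword.
rewrite (zidxK h1) (zidxK h2) (zidxK h1') (zidxK h2') stuffle_idx_cons.
by rewrite -natrM mulnb.
Qed.

Lemma tstuffle_unique (star : ht -> ht -> ht) (f g : ht) :
  is_tstuffle star -> in_ht1 f -> in_ht1 g -> star f g = tstuffle f g.
Proof.
move=> [cl ll lr s1l s1r szz] hf hg.
have wd s : in_ht1 << zword s >> by rewrite zwordE; apply: prodz_ht1.
have E s1 s2 : all (leq 1) s1 -> all (leq 1) s2 ->
    star << zword s1 >> << zword s2 >> = stuffle_idx s1 s2.
  elim: s1 s2 => [|k s1 IH1] s2.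
    by move=> _ _; rewrite -word1 s1l // stuffle_idx0l zwordE.
  elim: s2 => [|l s2 IH2].
    by move=> _ _; rewrite -word1 s1r // stuffle_idx0r zwordE.
  move=> h1' h2'; have /andP[k0 h1] := h1'; have /andP[l0 h2] := h2'.
  have := szz k l _ _ k0 l0 (wd s1) (wd s2).
  generalize (zMword k s1) (zMword l s2).
  generalize (z k * << zword s1 >>) (z l * << zword s2 >>) => _ _ -> -> ->.
  rewrite (IH1 _ h1 h2') (IH1 _ h1 h2) (IH2 h1' h2) stuffle_idx_cons.
  by rewrite !delta_zword -natrM mulnb.
have S0 : forall h, in_ht1 h -> star 0 h = 0.
  move=> h hh; have := ll 1 _ _ _ in_ht10 in_ht10 hh.
  by rewrite !scale1r addr0 -[LHS]addr0 => /addrI.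
have S0' : forall h, in_ht1 h -> star h 0 = 0.
  move=> h hh; have := lr 1 _ _ _ hh in_ht10 in_ht10.
  by rewrite !scale1r addr0 -[LHS]addr0 => /addrI.
have D (h : ht) : in_ht1 h -> h = \sum_(w <- msupp h) h@_w *: << w >>.
  move=> _; rewrite {1}(monalgE h); apply: eq_bigr => w _.
  by rewrite -mul_malgC malgM_def fgmulUU mul1m mulr1.
have EW (w : word) : endsy w -> in_ht1 << w >> by move=> hw; rewrite -(zwordK hw).
have suml (s : seq word) (c : word -> Qt) (h : ht) : in_ht1 h ->
    {in s, forall w : word, endsy w} ->
    star (\sum_(w <- s) c w *: << w >>) h = \sum_(w <- s) c w *: star << w >> h.
  move=> hh; elim: s => [|w s IH] hs; first by rewrite !big_nil S0.
  have hs' : {in s, forall w : word, endsy w}.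
    by move=> v hv; apply: hs; rewrite inE hv orbT.
  rewrite !big_cons ll ?IH //; first by apply/EW/hs; rewrite inE eqxx.
  by apply: in_ht1_sum => v /hs' hv; apply/in_ht1Z/EW.
have sumr (s : seq word) (c : word -> Qt) (h : ht) : in_ht1 h ->
    {in s, forall w : word, endsy w} ->
    star h (\sum_(w <- s) c w *: << w >>) = \sum_(w <- s) c w *: star h << w >>.
  move=> hh; elim: s => [|w s IH] hs; first by rewrite !big_nil S0'.
  have hs' : {in s, forall w : word, endsy w}.
    by move=> v hv; apply: hs; rewrite inE hv orbT.
  rewrite !big_cons lr ?IH //; first by apply/EW/hs; rewrite inE eqxx.
  by apply: in_ht1_sum => v /hs' hv; apply/in_ht1Z/EW.
have hfs w : w \in (msupp f : seq word) -> endsy w by exact: in_ht1_supp_endsy.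
have hgs w : w \in (msupp g : seq word) -> endsy w by exact: in_ht1_supp_endsy.
rewrite tstuffleEl.
apply: etrans (congr1 (star^~ g) (D f hf)) _.
apply: etrans (suml _ _ _ hg hfs) _.
apply: eq_big_seq => w1 /hfs h1; congr (_ *: _).
apply: etrans (congr1 (star _) (D g hg)) _.
apply: etrans (sumr _ _ _ (EW _ h1) hgs) _.
apply: eq_big_seq => w2 /hgs h2; congr (_ *: _).
by rewrite -{1}(zwordK h1) -{1}(zwordK h2) E // zidx_rec_pos.
Qed.

Transparent tstuffle stuffle_idx.

(* Main.v *)
Require Import Defs.
From mathcomp Require Import all_boot all_order all_algebra.
From mathcomp.multinomials Require Import monalg.

Import GRing.Theory.
Local Open Scope ring_scope.

(** Unfolding the t-stuffle of z_p^n with z_u z_p^v repeatedly gives a first-order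
    linear recurrence in n, each step of which peels off one z_p on the left; the
    inhomogeneous terms are those in which the letter z_u has been consumed. One
    application of the defining recursion to z_m z_p^n and z_u z_p^v, followed by
    the solution of this recurrence (once directly, once through commutativity),
    gives the sum. *)

(* The identities between sums are proved in an abstract algebra: rewriting with
   ring laws in ht itself makes unification unfold the monoid algebra. *)
Lemma linear_recurrence_sum (K : nzRingType) (A : lalgType K) (a b c e : A)
    (q : K) (d : nat -> K) (R S : nat -> A) :
  (forall k (f g : A), f * (k *: g) = k *: (f * g)) ->
  R 0%N = b * S 0%N ->
  (forall n, R n.+1 = a * R n + b * S n.+1
                      + q *: (c * S n) + d n *: (e * S n)) ->
  forall n, R n =
    \sum_(1 <= i < n.+1)
       (a ^+ i * b + q *: (a ^+ i.-1 * c) + d (n - i)%N *: (a ^+ i.-1 * e))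
       * S (n - i)%N
    + b * S n.
Proof.
move=> scAr R0 RS; elim=> [|n IH]; first by rewrite big_geq // add0r.
(* The [i = 1] term of the new sum combines [a] times the residue [b * S n] of [IH] with the [q] and
   [d n] terms of the recurrence. *)
rewrite RS IH (@big_nat_recl _ _ _ n.+1) // mulrDr mulr_sumr subSS subn0.
rewrite expr0 expr1 !mul1r.
have -> : \sum_(1 <= i < n.+1)
    (a ^+ i.+1 * b + q *: (a ^+ i.+1.-1 * c)
     + d (n.+1 - i.+1)%N *: (a ^+ i.+1.-1 * e))
    * S (n.+1 - i.+1)%N
  = \sum_(1 <= i < n.+1) a *
    ((a ^+ i * b + q *: (a ^+ i.-1 * c) + d (n - i)%N *: (a ^+ i.-1 * e))
     * S (n - i)%N).
  (* The bound [1 <= i] matters: [a * a ^+ i.-1 = a ^+ i] can fail at [i = 0]. *)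
  apply: eq_big_nat => -[|i] // _.
  by rewrite subSS !mulrA !mulrDr !scAr !mulrA -!exprS.
rewrite !mulrDl -!scalerAl -!mulrA.
set T := \sum_(_ <= _ < _) _; set b1 := b * S n.+1.
by rewrite (addrAC _ b1) (addrAC _ b1) (addrC T) !(addrAC _ T).
Qed.

Lemma addr_swap (V : zmodType) (a b c d : V) : a + b + c + d = b + a + c + d.
Proof. by rewrite (addrC a). Qed.

(** Exchanging the arguments swaps the first two terms of the recursion and preserves the other
    two. *)
Lemma stuffle_idxC (ks ls : seq nat) : stuffle_idx ks ls = stuffle_idx ls ks.
Proof.
elim: ks ls => [|k ks IHk] ls; first by rewrite stuffle_idx0l stuffle_idx0r.
elim: ls => [|l ls IHl]; first by rewrite stuffle_idx0l stuffle_idx0r.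
rewrite !stuffle_idx_cons (IHk (l :: ls)) IHl (IHk ls) (addnC k) andbC.
exact: addr_swap.
Qed.

Lemma zword_nseq (n p : nat) : << zword (nseq n p) >> = z p ^+ n :> ht.
Proof. by rewrite zwordE big_nseq -Monoid.iteropE. Qed.

Lemma zword_cons_nseq (m n p : nat) :
  << zword (m :: nseq n p) >> = z m * z p ^+ n :> ht.
Proof. by rewrite -zMword zword_nseq. Qed.

Lemma tstuffle_zword (ks ls : seq nat) : all (leq 1) ks -> all (leq 1) ls ->
  tstuffle << zword ks >> << zword ls >> = stuffle_idx ks ls.
Proof. by move=> hk hl; rewrite tstuffleUU (zidxK hk) (zidxK hl). Qed.

Lemma nilp_nseq (T : Type) (n : nat) (a : T) : nilp (nseq n a) = (n == 0%N).
Proof. by case: n. Qed.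

(** Here [d] varies with the number of letters [z p] left, since the power of [x] disappears exactly
    when both remainders are empty. *)
Lemma stuffle_idx_nseq_cons (u p n v : nat) :
  stuffle_idx (nseq n p) (u :: nseq v p) =
    \sum_(1 <= i < n.+1)
       (z p ^+ i * z u
        + (1 - 2%:R * t) *: (z p ^+ i.-1 * z (u + p))
        + ((1 - kron v 0 * kron (n - i) 0) * (t ^+ 2 - t))
            *: (z p ^+ i.-1 * x ^+ (u + p)))
       * stuffle_idx (nseq v p) (nseq (n - i) p)
  + z u * stuffle_idx (nseq v p) (nseq n p).
Proof.
apply: (@linear_recurrence_sum _ _ (z p) (z u) (z (u + p)) (x ^+ (u + p))
  (1 - 2%:R * t) (fun k => (1 - kron v 0 * kron k 0) * (t ^+ 2 - t))
  (fun n => stuffle_idx (nseq n p) (u :: nseq v p))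
  (fun n => stuffle_idx (nseq v p) (nseq n p))).
- exact: ht_scaleAr.
- by rewrite stuffle_idx0l stuffle_idx0r big_cons.
move=> k; rewrite [nseq k.+1 p]/= stuffle_idx_cons !nilp_nseq.
by rewrite (addnC p) -!(stuffle_idxC (nseq v p)) /kron -natrM mulnb andbC.
Qed.

(** The residues [b * S] and [a * S] of the two solved recurrences supply [a * b + b * a] in the
    last factor. *)
Lemma recursion_step_sums (K : nzRingType) (A : lalgType K) (a b c e : A)
    (q d : K) (r1 r2 : nat) (F G F' G' : nat -> A) (S : A) :
  a * (\sum_(1 <= i < r1) F i * G i + b * S)
  + b * (\sum_(1 <= i < r2) F' i * G' i + a * S) + q *: (c * S) + d *: (e * S)
  = \sum_(1 <= i < r1) a * F i * G i + \sum_(1 <= i < r2) b * F' i * G' i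
    + (a * b + b * a + q *: c + d *: e) * S.
Proof.
have pull (w : A) k (H L : nat -> A) :
    \sum_(1 <= i < k) w * H i * L i = w * \sum_(1 <= i < k) H i * L i.
  by rewrite mulr_sumr; apply: eq_bigr => i _; rewrite mulrA.
by rewrite !pull !mulrDr !mulrDl -!scalerAl -!mulrA addrACA !addrA.
Qed.

Theorem theorem2 (m u p n v : nat) (hm : (0 < m)%N) (hu : (0 < u)%N)
    (hp : (0 < p)%N) :
  tstuffle (z m * z p ^+ n) (z u * z p ^+ v) =
    \sum_(1 <= i < n.+1)
       z m * (z p ^+ i * z u
              + (1 - 2%:R * t) *: (z p ^+ i.-1 * z (u + p))
              + ((1 - kron v 0 * kron n i) * (t ^+ 2 - t))
                  *: (z p ^+ i.-1 * x ^+ (u + p)))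
           * tstuffle (z p ^+ v) (z p ^+ (n - i))
  + \sum_(1 <= i < v.+1)
       z u * (z p ^+ i * z m
              + (1 - 2%:R * t) *: (z p ^+ i.-1 * z (m + p))
              + ((1 - kron n 0 * kron v i) * (t ^+ 2 - t))
                  *: (z p ^+ i.-1 * x ^+ (m + p)))
           * tstuffle (z p ^+ n) (z p ^+ (v - i))
  + (z m * z u + z u * z m
     + (1 - 2%:R * t) *: z (m + u)
     + ((1 - kron n 0 * kron v 0) * (t ^+ 2 - t)) *: x ^+ (m + u))
      * tstuffle (z p ^+ n) (z p ^+ v).
Proof.
have pos k : all (leq 1) (nseq k p) by rewrite all_nseq hp orbT.
have ppE a b : tstuffle (z p ^+ a) (z p ^+ b) = stuffle_idx (nseq a p) (nseq b p).
  by rewrite -!zword_nseq tstuffle_zword.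
(* This needs [i <= k]: beyond it, truncated subtraction would make the right side 1. *)
have kronB k i : (1 <= i < k.+1)%N -> kron k i = kron (k - i) 0.
  by case/andP=> _; rewrite ltnS /kron subn_eq0 eqn_leq => ->; rewrite andbT.
have -> : tstuffle (z m * z p ^+ n) (z u * z p ^+ v)
    = stuffle_idx (m :: nseq n p) (u :: nseq v p).
  rewrite -(zword_cons_nseq m) -(zword_cons_nseq u).
  by apply: tstuffle_zword; rewrite /= ?hm ?hu pos.
rewrite ppE.
under eq_big_nat => i hi do rewrite ppE (kronB _ _ hi).
under [X in _ + X + _]eq_big_nat => i hi do rewrite ppE (kronB _ _ hi).
(* After the swap, the solved recurrence also applies with [m] in the role of [u] and with [n] and
   [v] exchanged. *)
rewrite stuffle_idx_cons (stuffle_idxC (m :: _)) !stuffle_idx_nseq_cons.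
rewrite (stuffle_idxC (nseq v p) (nseq n p)) !nilp_nseq -mulnb natrM.
exact: recursion_step_sums.
Qed.
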